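(* Let $N\in\mathbb{N}$, write $N=2k$ or $N=2k+1$, let $w_0,\dotsc,w_{N-1}\ge0$ be weights with $W=\operatorname{circ}(w_0,\dotsc,w_{N-1})\in\mathbb{R}^{N\times N}$ such that the underlying Circulant Laplacian Dynamics (CLD) protocol is gathering, and consider the Nonlinear Scaling of Circulant Laplacian Dynamics (NSCLD) protocol $$\dot z_i=\mathcal{N}\Big(-z_i+\sum_{j=0}^{N-1}w_jz_{i+j}\Big),\qquad \mathcal{N}(x,y)=n(\|(x,y)\|_2)\begin{pmatrix}x\\ y\end{pmatrix},\quad i=0,\dotsc,N-1,$$ with $\mathcal{N}(0)=0$ and a non-negative function $n$. Let $E$ be the edge set of the interaction graph and $\mathcal{C}>0$. Let $z_0(0),\dotsc,z_{N-1}(0)\in\mathbb{R}^2$ be an initial configuration lying in one of the subspaces $V_j^\pm\subseteq\mathbb{R}^{2N}$, $1\le j\le k$, defined in the context, with $$\|z_p(0)-z_q(0)\|\le\mathcal{C}\quad\text{for all }(q,p)\in E.$$ Then visibility is preserved under the dynamics, i.e. $$\|z_p(t)-z_q(t)\|\le\mathcal{C}\quad\text{for all }t\ge0\text{ and all }(q,p)\in E.$$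
   Context: $N$ robots with positions $z_i=(x_i,y_i)\in\mathbb{R}^2$, $i=0,\dotsc,N-1$ (indices modulo $N$), are collected in $Z=(X,Y)\in\mathbb{R}^{2N}$, $X=(x_0,\dotsc,x_{N-1})$, $Y=(y_0,\dotsc,y_{N-1})$; $\|\cdot\|$ is the Euclidean norm. $\operatorname{circ}(w_0,\dotsc,w_{N-1})$ is the circulant matrix with entries $W_{i,j}=w_{(j-i)\bmod N}$. All weights are non-negative. The interaction graph has vertices $\{0,\dotsc,N-1\}$ and edge set $E=\{(j,i):W_{i,j}\ne0\}$. $\mathcal{C}$ is the constant viewing range; it does not enter the differential equations. The underlying CLD protocol is $\dot z_i=-z_i+\sum_{j=0}^{N-1}w_jz_{i+j}$. It is gathering if, for every initial configuration, its solution converges as $t\to\infty$ to a gathering point (there is $z^*\in\mathbb{R}^2$ with $z_i(t)\to z^*$ for all $i$) and every gathering point is an equilibrium ($\dot z_i=0$ for all $i$ whenever $z_0=\dotsb=z_{N-1}$). The function $n$ takes values in $\mathbb{R}_{\ge0}$; it may be undefined at $0$ (e.g. $n(r)=1/r$), in which case $\mathcal{N}(0)=0$ is imposed. Let $\omega=\exp(2\pi\mathbf{i}/N)$, $v_j=(1,\omega^j,\dotsc,\omega^{(N-1)j})^T\in\mathbb{C}^N$, with entrywise real and imaginary parts. For $1\le j\le k$ (excluding $j=k$ when $N=2k$): $$V_j^+=\operatorname{span}\left(\begin{pmatrix}\Re(v_j)\\-\Im(v_j)\end{pmatrix},\begin{pmatrix}\Im(v_j)\\ \Re(v_j)\end{pmatrix}\right),\qquad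 V_j^-=\operatorname{span}\left(\begin{pmatrix}-\Im(v_j)\\ \Re(v_j)\end{pmatrix},\begin{pmatrix}\Re(v_j)\\ \Im(v_j)\end{pmatrix}\right).$$ For $N=2k$ and $j=k$ the vector $v_k$ is real and $V_k^+=\operatorname{span}\begin{pmatrix}v_k\\ 0\end{pmatrix}$, $V_k^-=\operatorname{span}\begin{pmatrix}0\\ v_k\end{pmatrix}$. The right-hand side of the NSCLD system maps each $V_j^\pm$ into itself, and the solution with initial configuration in $V_j^\pm$ is understood as the solution $Z(t)$, $t\ge0$, of the system restricted to $V_j^\pm$, i.e. $Z(t)\in V_j^\pm$ for all $t\ge 0$ (existence of the solution for $t\ge0$ is tacitly assumed). *)

(* Defs.v *)
From HB Require Import structures.
From mathcomp Require Import all_boot all_order all_algebra.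
From mathcomp Require Import all_classical all_reals all_analysis.
From mathcomp Require Import complex.

Set Implicit Arguments.
Unset Strict Implicit.
Unset Printing Implicit Defensive.

Import Order.TTheory GRing.Theory Num.Theory numFieldNormedType.Exports.

Local Open Scope classical_set_scope.
Local Open Scope ring_scope.

(* Z = (X, Y) in R^(2N) is stored as the column vector col_mx X Y. *)
Definition config (R : realType) (N : nat) := 'cV[R]_(N + N).

Definition robot (R : realType) (N : nat) (Z : config R N) (i : 'I_N) : R * R :=
  (usubmx Z i 0, dsubmx Z i 0).

Definition config_of (R : realType) (N : nat) (f : 'I_N -> R * R) :
    config R N :=
  col_mx (\col_i (f i).1) (\col_i (f i).2).

(* The norm that the library puts on R * R is the sup norm. *)
Definition norm2 (R : realType) (z : R * R) : R :=
  Num.sqrt (z.1 ^+ 2 + z.2 ^+ 2).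

(* Here, and wherever the number of robots is N = m.+1, the sum and the
   difference of indices in 'I_m.+1 are taken modulo N. *)
Definition circ (R : realType) (m : nat) (w : 'I_m.+1 -> R) : 'M[R]_m.+1 :=
  \matrix_(i, j) w (j - i).

(* The pair (j, i) is an edge when W i j is nonzero. *)
Definition edges (R : realType) (m : nat) (w : 'I_m.+1 -> R) :
    {set 'I_m.+1 * 'I_m.+1} :=
  [set e | circ w e.2 e.1 != 0].

Definition cld_velocity (R : realType) (m : nat) (w : 'I_m.+1 -> R)
    (Z : config R m.+1) (i : 'I_m.+1) : R * R :=
  - robot Z i + \sum_j w j *: robot Z (i + j).

Definition cld (R : realType) (m : nat) (w : 'I_m.+1 -> R)
    (Z : config R m.+1) : config R m.+1 :=
  config_of (cld_velocity w Z).

(* The value n 0 is never used, so n may be undefined there. *)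
Definition nscale (R : realType) (n : R -> R) (z : R * R) : R * R :=
  if z == 0 then 0 else n (norm2 z) *: z.

Definition nscld (R : realType) (m : nat) (n : R -> R) (w : 'I_m.+1 -> R)
    (Z : config R m.+1) : config R m.+1 :=
  config_of (fun i => nscale n (cld_velocity w Z i)).

(* A forward solution of Z' = F(Z) that is allowed not to satisfy the equation
   at the times in S; classical solutions are those with S = set0. Exceptional
   times are needed for scalings such as n(r) = 1/r: there robots reach their
   limit in finite time and then stop, so that Z has a corner at that time. *)
Definition solution_off (R : realType) (N : nat) (S : set R)
    (F : config R N -> config R N) (Z : R -> config R N) : Prop :=
  {within `[0, +oo[, continuous Z} /\
  forall t : R, 0 < t -> ~ S t -> is_derive t (1 : R) Z (F (Z t)).

Definition gathering_point (R : realType) (N : nat) (Z : config R N) : Prop :=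
  forall i j : 'I_N, robot Z i = robot Z j.

Definition cld_gathering (R : realType) (m : nat) (w : 'I_m.+1 -> R) : Prop :=
  (forall Z : R -> config R m.+1, solution_off set0 (cld w) Z ->
     exists zstar : R * R,
       forall i, robot (Z t) i @[t --> +oo] --> zstar) /\
  (forall Z : config R m.+1, gathering_point Z ->
     forall i, cld_velocity w Z i = 0).

Definition cexp (R : realType) (z : R[i]) : R[i] :=
  ((expR (complex.Re z))%:C *
   (cos (complex.Im z) +i* sin (complex.Im z)))%C.

Definition omega (R : realType) (N : nat) : R[i] :=
  cexp ((2 * pi / N%:R)%:C * 'i)%C.

Definition vvec (R : realType) (N j : nat) : 'cV[R[i]]_N :=
  \col_(l < N) omega R N ^+ (l * j).

Definition revec (R : realType) (N j : nat) : 'cV[R]_N :=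
  map_mx (@complex.Re R) (vvec R N j).

Definition imvec (R : realType) (N j : nat) : 'cV[R]_N :=
  map_mx (@complex.Im R) (vvec R N j).

(* The case N = j.*2 is the one of the real vector v_k for N = 2k. *)
Definition Vplus (R : realType) (N j : nat) : {vspace config R N} :=
  if N == j.*2 then <[col_mx (revec R N j) 0]>%VS
  else <<[:: col_mx (revec R N j) (- imvec R N j);
             col_mx (imvec R N j) (revec R N j)]>>%VS.

Definition Vminus (R : realType) (N j : nat) : {vspace config R N} :=
  if N == j.*2 then <[col_mx 0 (revec R N j)]>%VS
  else <<[:: col_mx (- imvec R N j) (revec R N j);
             col_mx (revec R N j) (imvec R N j)]>>%VS.

(* Main.v *)
(* On V the robots are at z_l = e^(i l phi) z_0, so z_0' is a non-negative multiple
   of (mu + i nu) z_0 with mu = \sum_l w_l cos (l phi) - 1. Gathering points being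
   equilibria forces \sum_l w_l = 1, hence mu <= 0 and |z_0| does not increase.
   Every distance |z_p - z_q| is a constant multiple of |z_0|. *)
Require Import Defs.
From HB Require Import structures.
From mathcomp Require Import all_boot all_order all_algebra.
From mathcomp Require Import all_classical all_reals all_analysis.
From mathcomp Require Import complex ring lra.

Import Order.TTheory GRing.Theory Num.Theory numFieldNormedType.Exports.

Local Open Scope classical_set_scope.
Local Open Scope ring_scope.

(** * Monotonicity from the sign of a derivative off a countable set *)

(** A countable set is Lebesgue null, whereas the interval has measure [b - a > 0]. *)
Lemma itv_oo_avoids_countable (R : realType) (A : set R) (a b : R) :
  countable A -> a < b -> exists2 y, a < y < b & ~ A y.
Proof.
move=> cA ab; apply: contrapT => noy.
have sub : [set` `]a, b[] `<=` A.
  move=> y /=; rewrite in_itv /= => yab; apply: contrapT => Ay.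
  by apply: noy; exists y.
have := countable_lebesgue_measure0 (sub_countable (subset_card_le sub) cA).
rewrite lebesgue_measure_itv /= lte_fin ab -EFinD => /eqP.
by rewrite eqe subr_eq0 gt_eqF.
Qed.

(* If f a < f b, some value y between them is not taken on S; at the last point
   x where f <= y we get f x = y and f > y on the right of x, so f' x >= 0. *)
Lemma le_of_derive_lt0_off_countable (R : realType) (f : R -> R) (S : set R)
    (a b : R) :
  a <= b -> countable S -> {within `[a, b], continuous f} ->
  (forall t, a < t < b -> ~ S t -> exists2 d, is_derive t (1 : R) f d & d < 0) ->
  f b <= f a.
Proof.
move=> ab cS /subspace_continuousP cf df; rewrite leNgt; apply/negP => fab.
have {}cf (x : R) : [set` `[a, b]] x -> f @ within [set` `[a, b]] (nbhs x) --> f x.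
  exact: cf.
have [|y /andP[ay yb] Sy] := @itv_oo_avoids_countable R (f @` S) (f a) (f b) _ fab.
  exact: sub_countable (card_image_le _ _) cS.
pose A := [set t | a <= t <= b /\ f t <= y].
have hA : has_sup A.
  split; first by exists a; split; [rewrite lexx ab | exact: ltW].
  by exists b => t [/andP[]].
set x := sup A.
have ubA : forall t, A t -> t <= x := sup_upper_bound hA.
have ax : a <= x by apply: ubA; split; [rewrite lexx ab | exact: ltW].
have xb : x <= b by apply: ge_sup; [exact: hA.1 | move=> t [/andP[]]].
have axb : [set` `[a, b]] x by rewrite /= in_itv /= ax xb.
have fxy : f x = y.
  apply/eqP; rewrite eq_le; apply/andP; split; rewrite leNgt; apply/negP => fx.
  (* If [f x > y], then [f > y] on [[a, b]] near [x], yet [A] has points arbitrarily close to its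
     supremum. *)
  - have : nbhs x [set t | [set` `[a, b]] t -> y < f t].
      exact: (cvgr_gt _ (cf x axb) _ fx).
    move=> /nbhs_ballP[e /= e0 he].
    have [t [/andP[tA1 tA2] tA3] xt] := sup_adherent e0 hA.
    have tx : t <= x by apply: ubA; split; rewrite ?tA1.
    have : y < f t; last by rewrite ltNge tA3.
    apply: he; last by rewrite /= in_itv /= tA1 tA2.
    by rewrite /ball /= ger0_norm; rewrite -/x in xt; lra.
  (* If [f x < y], then [f < y] slightly to the right of [x], so [A] has a point beyond its
     supremum. *)
  - have : nbhs x [set t | [set` `[a, b]] t -> f t < y].
      exact: (cvgr_lt _ (cf x axb) _ fx).
    move=> /nbhs_ballP[e /= e0 he].
    have xb' : x < b.
      by rewrite lt_neqAle xb andbT; apply/eqP => xE; move: fx yb; rewrite xE; lra.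
    pose t := Num.min (x + e / 2) b.
    have xt : x < t by rewrite lt_min xb' andbT; lra.
    have te : t <= x + e / 2 by rewrite ge_min lexx.
    have tb : t <= b by rewrite ge_min lexx orbT.
    have : A t.
      split; first by apply/andP; split; lra.
      apply/ltW/he; first by rewrite /ball /= ler0_norm; lra.
      by rewrite /= in_itv /=; apply/andP; split; lra.
    by move=> /ubA; rewrite leNgt xt.
have ax' : a < x.
  by rewrite lt_neqAle ax andbT; apply/eqP => xE; move: ay; rewrite -fxy -xE ltxx.
have xb' : x < b.
  by rewrite lt_neqAle xb andbT; apply/eqP => xE; move: yb; rewrite -fxy -xE ltxx.
have [|Sx|d dfx d0] := df x; first by rewrite ax' xb'.
  by apply: Sy; exists x.
have [/cvg_ex[/= l hl] dE] := dfx.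
have ld : l = d by rewrite -dE; exact/esym/(cvg_lim _ hl).
rewrite ld in hl.
(* A negative limit makes the difference quotient negative near 0, so [f t < f x = y] slightly to
   the right of [x]: again [A] has a point beyond its supremum. *)
have : nbhs (0 : R) [set h | h != 0 -> h^-1 *: (f (h *: 1 + x) - f x) < 0].
  exact: (cvgr_lt _ hl _ d0).
move=> /nbhs_ballP[e /= e0 he].
pose t := Num.min (x + e / 2) b.
have xt : x < t by rewrite lt_min xb' andbT; lra.
have te : t <= x + e / 2 by rewrite ge_min lexx.
have tb : t <= b by rewrite ge_min lexx orbT.
have t0 : 0 < t - x by lra.
have := he (t - x); rewrite /ball /= sub0r normrN gtr0_norm //.
have -> : (t - x < e) = true by apply/idP; lra.
rewrite /= => /(_ isT) /(_ (lt0r_neq0 t0)).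
rewrite scaler1 subrK /GRing.scale/= pmulr_rlt0 ?invr_gt0// fxy subr_lt0 => fty.
have /ubA : A t by split; [apply/andP; split; lra | exact: ltW].
by rewrite leNgt xt.
Qed.

(** Subtracting [c * t] with a small [c > 0] makes the derivative strictly negative; the error this
    causes is at most an arbitrary [e]. *)
Lemma le_of_derive_le0_off_countable (R : realType) (f : R -> R) (S : set R)
    (a b : R) :
  a <= b -> countable S -> {within `[a, b], continuous f} ->
  (forall t, a < t < b -> ~ S t -> exists2 d, is_derive t (1 : R) f d & d <= 0) ->
  f b <= f a.
Proof.
move=> ab cS cf df; apply/ler_addgt0Pr => e e0.
(* This slope gives [c * (b - a) <= e]; the [+ 1] keeps the denominator positive when [a = b]. *)
pose c := e / (b - a + 1).
have c0 : 0 < c by rewrite divr_gt0 //; lra.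
have : f b - c * b <= f a - c * a.
  apply: (@le_of_derive_lt0_off_countable _ (fun t => f t - c * t) S) => //.
  - move=> t; apply: cvgB; first exact: cf.
    apply: cvgM; first exact: cvg_cst.
    have := @continuous_subspaceT R R [set` `[a, b]] id (fun x => cvg_id); exact.
  - move=> t tab St; have [d dft d0] := df t tab St.
    exists (d - c); last by lra.
    rewrite (_ : (fun _ => _) = f - (c \*: @id R)); last by apply/funext.
    by apply: is_derive_eq; rewrite /GRing.scale/= mulr1.
have : c * (b - a) <= e.
  by rewrite /c mulrAC ler_pdivrMr; nra.
by rewrite mulrBr; lra.
Qed.

(** * Configurations in [Vplus] and [Vminus] as rotated copies of one robot *)

(** With R * R read as the complex plane, this is multiplication by e^(i phi). *)
Definition rot {R : realType} (phi : R) (z : R * R) : R * R :=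
  (z.1 * cos phi - z.2 * sin phi, z.1 * sin phi + z.2 * cos phi).

Lemma omegaX (R : realType) (N l : nat) :
  omega R N ^+ l =
  (cos (l%:R * (2 * pi / N%:R)) +i* sin (l%:R * (2 * pi / N%:R)))%C.
Proof.
have -> : omega R N = (cos (2 * pi / N%:R) +i* sin (2 * pi / N%:R))%C.
  rewrite /omega /cexp; apply/eqP; rewrite eq_complex /=.
  by rewrite !(mulr0, mul0r, mulr1, mul1r, addr0, add0r, oppr0, expR0) !eqxx.
elim: l => [|l IHl]; first by rewrite expr0 mul0r cos0 sin0.
rewrite exprS IHl; set t : R := 2 * pi / _.
have -> : l.+1%:R * t = t + l%:R * t by rewrite -natr1; ring.
rewrite cosD sinD.
by apply/eqP; rewrite eq_complex /= [X in _ && (X == _)]addrC !eqxx.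
Qed.

Lemma robot_col_mx (R : realType) (N : nat) (A B : 'cV[R]_N) (i : 'I_N) :
  robot (col_mx A B) i = (A i 0, B i 0).
Proof. by rewrite /robot col_mxKu col_mxKd. Qed.

Lemma robotD (R : realType) (N : nat) (A B : config R N) (i : 'I_N) :
  robot (A + B) i = robot A i + robot B i.
Proof. by rewrite /robot !mxE. Qed.

Lemma robotZ (R : realType) (N : nat) (a : R) (A : config R N) (i : 'I_N) :
  robot (a *: A) i = a *: robot A i.
Proof. by rewrite /robot !mxE. Qed.

Lemma mem_span2P (K : fieldType) (vT : vectType K) (u v z : vT) :
  reflect (exists a b, z = a *: u + b *: v) (z \in <<[:: u; v]>>%VS).
Proof.
rewrite span_cons span_seq1; apply: (iffP memv_addP).
  by move=> [_ /vlineP[a ->] [_ /vlineP[b ->] ->]]; exists a, b.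
move=> [a [b ->]]; exists (a *: u); first by rewrite memvZ ?memv_line.
by exists (b *: v); rewrite ?memvZ ?memv_line.
Qed.

(** In each generator, robot [l] is robot 0 turned by [- l * th] (for [Vplus]) or [l * th] (for
    [Vminus]), and rotations are linear. The angle depends on [V] alone, hence serves for all times
    at once. *)
Lemma robot_V (R : realType) (m j : nat) (V : {vspace config R m.+1}) :
  V = Vplus R m.+1 j \/ V = Vminus R m.+1 j ->
  exists phi : R, forall Z, Z \in V ->
    forall l : 'I_m.+1, robot Z l = rot (l%:R * phi) (robot Z ord0).
Proof.
set th : R := j%:R * (2 * pi / m.+1%:R).
have re (l : 'I_m.+1) : revec R m.+1 j l 0 = cos (l%:R * th).
  by rewrite !mxE omegaX /= natrM -mulrA.
have im (l : 'I_m.+1) : imvec R m.+1 j l 0 = sin (l%:R * th).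
  by rewrite !mxE omegaX /= natrM -mulrA.
(* For N = 2j the angle is pi, the sines vanish and turning by [l * th] is a change of sign; thus
   the single real generator also fits the rotation form. *)
have sin_half (l : nat) : m.+1 = j.*2 -> sin (l%:R * th) = 0.
  move=> mj; have -> : th = pi.
    have : m.+1%:R != 0 :> R by rewrite pnatr_eq0.
    rewrite /th mj -muln2 natrM mulf_eq0 negb_or => /andP[j0 _].
    by field.
  elim: l => [|l IHl]; first by rewrite mul0r sin0.
  by rewrite -natr1 mulrDl mul1r sinD IHl sinpi mul0r mulr0 addr0.
have scaleE a (x y : R) : a *: (x, y) = (a * x, a * y) by [].
have addE (x y x' y' : R) : (x, y) + (x', y') = (x + x', y + y') by [].
case=> ->; [exists (- th) | exists th] => Z; rewrite /Vplus /Vminus;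
  case: eqP => [mj /vlineP[a ->] l|_ /mem_span2P[a [b ->]] l];
  rewrite /rot ?mulrN ?cosN ?sinN ?robotD !robotZ !robot_col_mx !scaleE ?addE /=.
all: rewrite ?[(- imvec _ _ _) _ _]mxE ?[(0 : 'cV_ _) _ _]mxE !re ?im mul0r.
1, 3: rewrite sin_half //.
all: by rewrite cos0 ?sin0; congr pair; ring.
Qed.

(** * The velocity of robot 0 *)

Lemma cld_velocityE (R : realType) (m : nat) (w : 'I_m.+1 -> R)
    (Z : config R m.+1) (i : 'I_m.+1) :
  cld_velocity w Z i =
  (- (robot Z i).1 + \sum_l w l * (robot Z (i + l)).1,
   - (robot Z i).2 + \sum_l w l * (robot Z (i + l)).2).
Proof.
rewrite [LHS]surjective_pairing; congr pair; congr (_ + _).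
- exact: (big_morph (fun z : R * R => z.1)).
- exact: (big_morph (fun z : R * R => z.2)).
Qed.

(** In complex notation the velocity is [(mu + i nu) z] with mu + i nu = \sum_l w_l e^(i l phi) - 1.
    Robot 0 is chosen because its neighbour [ord0 + l] is [l] itself, without reduction modulo N. *)
Lemma cld_velocity_rot (R : realType) (m : nat) (w : 'I_m.+1 -> R)
    (Z : config R m.+1) (phi : R) :
  (forall l : 'I_m.+1, robot Z l = rot (l%:R * phi) (robot Z ord0)) ->
  let mu := \sum_(l < m.+1) w l * cos (l%:R * phi) - 1 in
  let nu := \sum_(l < m.+1) w l * sin (l%:R * phi) in
  let z := robot Z ord0 in
  cld_velocity w Z ord0 = (mu * z.1 - nu * z.2, nu * z.1 + mu * z.2).
Proof.
move=> rotZ mu nu z; rewrite cld_velocityE -/z; congr pair.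
- have -> : \sum_l w l * (robot Z (ord0 + l)).1 =
      \sum_(l < m.+1) (w l * cos (l%:R * phi) * z.1 -
                       w l * sin (l%:R * phi) * z.2).
    by apply: eq_bigr => l _; rewrite add0r rotZ -/z /rot; clearbody z => /=; ring.
  by rewrite sumrB -!mulr_suml /mu /nu; ring.
- have -> : \sum_l w l * (robot Z (ord0 + l)).2 =
      \sum_(l < m.+1) (w l * sin (l%:R * phi) * z.1 +
                       w l * cos (l%:R * phi) * z.2).
    by apply: eq_bigr => l _; rewrite add0r rotZ -/z /rot; clearbody z => /=; ring.
  by rewrite big_split /= -!mulr_suml /mu /nu; ring.
Qed.

(** With all robots at (1, 0), the first coordinate of the velocity is [\sum_l w l - 1], which must
    vanish at an equilibrium. *)
Lemma cld_gathering_sum (R : realType) (m : nat) (w : 'I_m.+1 -> R) :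
  cld_gathering w -> \sum_l w l = 1.
Proof.
move=> [_ /(_ (config_of (fun _ => (1, 0))))].
have robotE i : robot (config_of (fun _ : 'I_m.+1 => (1 : R, 0 : R))) i = (1, 0).
  by rewrite robot_col_mx !mxE.
move=> /(_ (fun i j => etrans (robotE i) (esym (robotE j))) ord0).
rewrite cld_velocityE robotE.
under eq_bigr do rewrite robotE mulr1.
move=> /(congr1 fst) /=.
by move=> /eqP; rewrite addrC subr_eq0 => /eqP.
Qed.

(** This reduces the scaling to an unknown factor [s >= 0], which preserves signs; at [z = 0] the
    choice [s = 0] avoids the value of [n] there. *)
Lemma nscale_ge0 (R : realType) (n : R -> R) (z : R * R) :
  (forall r, 0 < r -> 0 <= n r) -> exists2 s, 0 <= s & nscale n z = s *: z.
Proof.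
move=> hn; rewrite /nscale; case: eqVneq => [->|z0].
  by exists 0; rewrite ?scaler0.
exists (n (norm2 z)) => //; apply: hn; rewrite sqrtr_gt0 lt_neqAle eq_sym.
rewrite addr_ge0 ?sqr_ge0 // andbT paddr_eq0 ?sqr_ge0 // !sqrf_eq0.
by apply: contra z0 => /andP[/eqP z1 /eqP z2]; rewrite [z]surjective_pairing z1 z2.
Qed.

Lemma is_derive_coord (R : realFieldType) (V : normedModType R) (m n : nat)
    (M : V -> 'M[R]_(m, n)) (t v : V) (D : 'M[R]_(m, n)) i j :
  is_derive t v M D -> is_derive t v (fun s => M s i j) (D i j).
Proof.
move=> [dM <-]; apply: DeriveDef; first exact: (derivable_mxP _ _ _).1.
by rewrite derive_mx // mxE.
Qed.

(** * Distances between robots and decay of the radius *)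

(** This is |e^(ia) z - e^(ib) z| = |e^(ia) - e^(ib)| |z|; the first factor depends on the angles
    only. *)
Lemma norm2_rotB (R : realType) (a b : R) (z : R * R) :
  norm2 (rot a z - rot b z) =
  Num.sqrt (((cos a - cos b) ^+ 2 + (sin a - sin b) ^+ 2) * (z.1 ^+ 2 + z.2 ^+ 2)).
Proof. by rewrite /norm2 /rot /=; congr Num.sqrt; ring. Qed.

(** The part of the velocity coming from [nu] is orthogonal to [z] and drops out of the derivative
    of |z|^2, leaving [2 * c * mu] times |z|^2. *)
Lemma robot0_nonincreasing (R : realType) (m : nat) (w : 'I_m.+1 -> R)
    (n : R -> R) (S : set R) (phi : R) (Z : R -> config R m.+1) :
  (forall l, 0 <= w l) -> \sum_l w l = 1 -> (forall r, 0 < r -> 0 <= n r) ->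
  countable S -> solution_off S (nscld n w) Z ->
  (forall t, 0 <= t -> forall l : 'I_m.+1,
     robot (Z t) l = rot (l%:R * phi) (robot (Z t) ord0)) ->
  forall t, 0 <= t ->
    (robot (Z t) ord0).1 ^+ 2 + (robot (Z t) ord0).2 ^+ 2 <=
    (robot (Z 0) ord0).1 ^+ 2 + (robot (Z 0) ord0).2 ^+ 2.
Proof.
move=> hw sw hn cS [cZ dZ] rotZ t t0.
pose x s : R := Z s (lshift m.+1 ord0) 0.
pose y s : R := Z s (rshift m.+1 ord0) 0.
have xE s : (robot (Z s) ord0).1 = x s by rewrite /= mxE.
have yE s : (robot (Z s) ord0).2 = y s by rewrite /= mxE.
rewrite !xE !yE.
apply: (@le_of_derive_le0_off_countable R (fun s => x s ^+ 2 + y s ^+ 2) S) => //.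
  have {}cZ : {within `[0, t], continuous Z}.
    apply: continuous_subspaceW cZ => s /=; rewrite !in_itv /= andbT.
    by move=> /andP[].
  have cx i : {within `[0, t], continuous (fun s => Z s i 0)}.
    move=> s; exact: (@continuous_comp (subspace [set` `[0, t]]) _ _ Z (fun M => M i 0)
      s (cZ s) (@coord_continuous R _ _ i 0 (Z s))).
  move=> s; apply: cvgD; rewrite expr2; apply: cvgM; exact: cx.
move=> s /andP[s0 _] Ss; have ds := dZ s s0 Ss.
have := @is_derive_coord _ _ _ _ _ _ _ _ (lshift m.+1 ord0) 0 ds.
have := @is_derive_coord _ _ _ _ _ _ _ _ (rshift m.+1 ord0) 0 ds.
have [c c0 cE] := nscale_ge0 _ n (cld_velocity w (Z s) ord0) hn.
rewrite /nscld col_mxEu col_mxEd !mxE cE (cld_velocity_rot _ _ _ _ _ (rotZ s (ltW s0))).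
rewrite xE yE -/x -/y.
set mu := _ - 1; set nu := \sum_l _ => dy dx.
(* Non-negative weights of sum 1 average cosines, each at most 1. *)
have mu0 : mu <= 0.
  rewrite subr_le0 -sw; apply: ler_sum => l _.
  by rewrite ler_piMr ?cos_le1.
exists (2 * c * mu * (x s ^+ 2 + y s ^+ 2)); last first.
  have : 0 <= c * (x s ^+ 2 + y s ^+ 2) by rewrite mulr_ge0 // addr_ge0 ?sqr_ge0.
  by nra.
rewrite (_ : (fun _ => _) = x ^+ 2 + y ^+ 2); last by apply/funext => u; rewrite !fctE.
apply: is_derive_eq; rewrite /GRing.scale /= /GRing.scale /=; ring.
Qed.

(* The number of robots is N = m.+1. *)
Theorem proposition5p2 (R : realType) (m k : nat)
  (hk : m.+1 = k.*2 \/ m.+1 = k.*2.+1)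
  (w : 'I_m.+1 -> R) (hw : forall l, 0 <= w l)
  (hgather : cld_gathering w)
  (n : R -> R) (hn : forall r : R, 0 < r -> 0 <= n r)
  (C : R) (hC : 0 < C)
  (j : nat) (hj : (1 <= j <= k)%N)
  (V : {vspace config R m.+1}) (hV : V = Vplus R m.+1 j \/ V = Vminus R m.+1 j)
  (S : set R) (hS : countable S)
  (Z : R -> config R m.+1)
  (hsol : solution_off S (nscld n w) Z)
  (hZ0 : Z 0 \in V)
  (hZV : forall t : R, 0 <= t -> Z t \in V)
  (hvis : forall q p : 'I_m.+1, (q, p) \in edges w ->
     norm2 (robot (Z 0) p - robot (Z 0) q) <= C) :
  forall t : R, 0 <= t -> forall q p : 'I_m.+1, (q, p) \in edges w ->
    norm2 (robot (Z t) p - robot (Z t) q) <= C.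
Proof.
move=> t t0 q p qp; apply: le_trans (hvis q p qp).
have [phi rotV] := robot_V _ _ _ _ hV.
have rotZ s : 0 <= s -> forall l : 'I_m.+1,
    robot (Z s) l = rot (l%:R * phi) (robot (Z s) ord0).
  by move=> s0; apply: rotV; apply: hZV.
rewrite (rotZ t t0 p) (rotZ t t0 q) (rotZ 0 (lexx 0) p) (rotZ 0 (lexx 0) q).
rewrite 2!norm2_rotB.
(* The factor from the angles of [p] and [q] is the same at times 0 and [t], so only the squared
   radii remain to be compared. *)
apply: ler_wsqrtr; apply: ler_wpM2l; first by rewrite addr_ge0 ?sqr_ge0.
apply: robot0_nonincreasing hw _ hn hS hsol rotZ t t0.
exact: cld_gathering_sum.
Qed.
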